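(* Let $0<q<1$. For any $x\in(0,\frac12]$, one has $$\frac{\Gamma_q(1-x)}{\Gamma_q(x)}\leq \Gamma_q\left(\frac{1-x}{x}\right),$$ with equality only for $x=\frac12$.
   Context: For $0<q<1$ and complex $a$, $(a;q)_\infty=\prod_{i=0}^{\infty}(1-aq^i)$. For real $x>0$, the $q$-gamma function is $\Gamma_q(x)=\frac{(q;q)_\infty}{(q^x;q)_\infty}(1-q)^{1-x}$. *)

(* Defs.v *)
From HB Require Import structures.
From mathcomp Require Import all_boot all_order all_algebra.
From mathcomp Require Import all_classical all_reals all_analysis.
Import Order.TTheory GRing.Theory Num.Theory.
Import numFieldNormedType.Exports.

Set Implicit Arguments.
Unset Strict Implicit.
Unset Printing Implicit Defensive.

Local Open Scope classical_set_scope.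
Local Open Scope ring_scope.

(* The base ring is an arbitrary numFieldType, so that both real and complex
   arguments are covered; over the reals or the complex numbers, the limit
   exists as soon as `|q| < 1. *)
Definition qPochhammer_inf (K : numFieldType) (a q : K) : K :=
  lim ((fun n : nat => \prod_(0 <= i < n) (1 - a * q ^+ i)) @ \oo).

(* Meant for 0 < q < 1 and 0 < x. *)
Definition qGamma (R : realType) (q x : R) : R :=
  qPochhammer_inf q q / qPochhammer_inf (q `^ x) q * (1 - q) `^ (1 - x).

(* Main.v *)
Require Import Defs.
From mathcomp Require Import all_boot all_order all_algebra.
From mathcomp Require Import all_classical all_reals all_analysis.
From mathcomp Require Import ring lra.
Import Order.TTheory GRing.Theory Num.Theory.
Import numFieldNormedType.Exports.

Local Open Scope ring_scope.

(** Put y = (1 - x) / x and s = (1 - 2x) y.  Clearing denominators, and using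
    s = x + (y - 1) - (1 - x), the strict inequality for x < 1/2 reads
      (q^x; q) (q^y; q) (1 - q)^s < (q; q) (q^(1-x); q),
    where (a; q) is the infinite product.  Expand the logarithms with
    - ln (1 - z) = sum_(k >= 1) z^k / k and
    - ln (a; q) = sum_(k >= 1) a^k / (k (1 - q^k)).  With t = q^k, the k-th
    term of the difference of the two logarithms is 1/k times
      s t + (t^x + t^y - t - t^(1-x)) / (1 - t),
    so everything follows from the one-variable inequality
      t^x + t^y - t - t^(1-x) + s t (1 - t) > 0   for 0 < t < 1
    ([powR_gap_gt0]).  Substituting t = e^(-u) and dividing by t, the left-hand
    side becomes a combination of exponentials of u which vanishes at u = 0
    and whose derivative is positive for u > 0 ([exp_gap_slope_gt0]); the
    latter only uses 1 + v <= e^v and the convexity of exp.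

    Double series are avoided by working with the products truncated at n
    factors.  This multiplies the second summand of the k-th term by
    r = 1 - t^n, which lies in [0, 1], so that the term stays above the minimum
    of s t and s t + (t^x + t^y - t - t^(1-x)) / (1 - t), both positive.
    Keeping this bound for k = 1 and 0 for all other k gives a gap between
    the two logarithms that does not depend on n ([qPoch_gap]); hence the
    inequality is still strict in the limit n -> oo. *)

(** * The one-variable inequality *)

Lemma is_derive_expR_scale (R : realType) (a u : R) :
  is_derive u 1 (fun v => expR (a * v)) (a * expR (a * u)).
Proof.
have h : is_derive u 1 ( *:%R a : R -> R) a.
  by apply: is_derive_eq; rewrite /GRing.scale/= mulr1.
have := @is_derive1_comp R expR ( *:%R a) u _ _ (is_derive_expR _) h.
by move=> k; apply: is_derive_eq; rewrite mulrC.
Qed.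

Lemma expR_chord (R : realType) (m u : R) : 0 <= m -> m <= 1 ->
  expR (- m * u) <= 1 - m + m * expR (- u).
Proof.
move=> m0 m1; have := convex_expR (Itv01 m0 m1) (- u) 0.
by rewrite !convRE /= expR0 mulr0 addr0 mulr1 mulrN mulNr addrC.
Qed.

(** Write d = 1 - 2x.  The first two terms are at least d (1 + u), and the last
    two, by the bound e^(-mu) <= e^(-u) + 2x (1 - e^(-u)) for m = d / x, are at
    least d (e^(-u) - 2).  The sum of these bounds is d (u - 1 + e^(-u)) > 0. *)
Lemma exp_gap_slope_gt0 (R : realType) (x u : R) :
  0 < x -> x < 1 / 2 -> 0 < u ->
  0 < (1 - x) * expR ((1 - x) * u) - x * expR (x * u)
      + (1 - 2 * x) * ((1 - x) / x) * expR (- u)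
      - (1 - 2 * x) / x * expR (- ((1 - 2 * x) / x) * u).
Proof.
move=> x0 x2 u0.
set m := (1 - 2 * x) / x.
have xm : x * m = 1 - 2 * x by rewrite /m mulrC divfK // gt_eqF.
have m0 : 0 <= m by rewrite divr_ge0; lra.
have -> : (1 - 2 * x) * ((1 - x) / x) = m * (1 - x) by rewrite /m; ring.
have E1 : expR (- u) > 1 - u by apply: expR_gt1Dx; rewrite oppr_eq0 gt_eqF.
have E2 : expR (- u) < 1 by rewrite -expR0 ltr_expR; lra.
have E0 := expR_gt0 (- u).
(* For m <= 1 the chord leaves the factor 1 - m, and 1 - m <= 2x because
   x - x m = 3x - 1 and 2x^2 - 3x + 1 = (1 - x) (1 - 2x) >= 0. *)
have hF : expR (- m * u) <= expR (- u) + 2 * x * (1 - expR (- u)).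
  have [m1|m1] := leP m 1.
    apply: (le_trans (expR_chord R m u m0 m1)).
    by nra.
  have : expR (- m * u) <= expR (- u) by rewrite ler_expR; nra.
  by nra.
have s1 := expR_ge1Dx ((1 - 2 * x) * u).
have s2 := expR_ge1Dx (x * u).
have -> : (1 - x) * u = x * u + (1 - 2 * x) * u by ring.
rewrite expRD.
move: (expR (x * u)) (expR ((1 - 2 * x) * u)) (expR (- u)) (expR (- m * u))
  s1 s2 E0 E1 E2 hF => A B E F s1 s2 E0 E1 E2 hF.
have k1 : (1 - x) * (A * B) - x * A >= (1 - 2 * x) * (1 + u).
  have : (1 - x) * (A * B) >= (1 - x) * (A * (1 + (1 - 2 * x) * u)).
    by rewrite ler_wpM2l ?ler_wpM2l //; nra.
  have : (1 - 2 * x) * (1 + (1 - x) * u) * (1 + x * u)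
     <= (1 - 2 * x) * (1 + (1 - x) * u) * A.
    have : 0 <= (1 - x) * u by rewrite mulr_ge0 //; lra.
    by move=> ?; rewrite ler_wpM2l // mulr_ge0 //; lra.
  have : 0 <= (1 - 2 * x) * ((1 - x) * u * (x * u)).
    by rewrite !mulr_ge0 //; lra.
  by lra.
have k2 : m * F <= m * (E + 2 * x * (1 - E)) by rewrite ler_wpM2l.
have k3 : m * (E + 2 * x * (1 - E)) = m * E + 2 * (x * m) * (1 - E) by ring.
have k4 : m * (1 - x) * E = m * E - (x * m) * E by ring.
rewrite k4; rewrite k3 in k2; rewrite xm in k2 *.
have k5 : 0 < (1 - 2 * x) * (u - 1 + E) by rewrite mulr_gt0; lra.
by lra.
Qed.

Lemma exp_gap_gt0 (R : realType) (x u : R) : 0 < x -> x < 1 / 2 -> 0 < u ->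
  0 < expR ((1 - x) * u) - expR (x * u)
      + (1 - 2 * x) * ((1 - x) / x) * (1 - expR (- u))
      - (1 - expR (- ((1 - 2 * x) / x) * u)).
Proof.
move=> x0 x2 u0.
pose m : R := (1 - 2 * x) / x; pose c : R := (1 - 2 * x) * ((1 - x) / x).
pose h : R -> R :=
   (fun v : R => expR ((1 - x) * v)) - (fun v : R => expR (x * v))
   + c *: (cst 1 - (fun v : R => expR ((-1) * v)))
   - (cst 1 - (fun v : R => expR (- m * v))).
have dh (v : R) : is_derive v 1 h
    ((1 - x) * expR ((1 - x) * v) - x * expR (x * v)
      + c * expR (- v) - m * expR (- m * v)).
  have e a := is_derive_expR_scale R a v.
  have k (a : R) : is_derive v 1
      (cst 1 - (fun v : R => expR (- a * v))) (a * expR (- a * v)).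
    have := is_deriveB (is_derive_cst (1 : R) v 1) (e (- a)).
    by rewrite sub0r mulNr opprK.
  have := is_deriveB (is_deriveD (is_deriveB (e (1 - x)) (e x)) 
    (is_deriveZ c (k 1))) (k m).
  by rewrite mul1r mulN1r.
have h0 : h 0 = 0.
  by rewrite /h !fctE /= /GRing.scale/= !mulr0 expR0 !subrr mulr0 subr0 addr0.
have [|z] := @MVT R h _ 0 u u0 (fun v _ => dh v).
  apply: derivable_within_continuous => v _.
  exact: ex_derive.
rewrite h0 !subr0 in_itv /= => /andP[z0 _].
rewrite /h !fctE /GRing.scale/= mulN1r => ->.
by rewrite mulr_gt0 // exp_gap_slope_gt0.
Qed.

Lemma powR_gap_gt0 (R : realType) (x t : R) :
  0 < x -> x < 1 / 2 -> 0 < t -> t < 1 ->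
  0 < t `^ x + t `^ ((1 - x) / x) - t - t `^ (1 - x)
      + (1 - 2 * x) * ((1 - x) / x) * t * (1 - t).
Proof.
move=> x0 x2 t0 t1.
have u0 : 0 < - ln t by rewrite oppr_gt0 ln_lt0 ?t0.
have tE : expR (ln t) = t by rewrite lnK.
have := exp_gap_gt0 R x _ x0 x2 u0.
rewrite opprK tE => h.
have tp (a : R) : t * expR (a * - ln t) = t `^ (1 - a).
  rewrite powRB; last by apply/implyP => _; rewrite gt_eqF.
  rewrite powRr1 ?(ltW t0) //.
  by rewrite /powR gt_eqF // mulrN expRN.
have e1 : t `^ x = t * expR ((1 - x) * - ln t) by rewrite tp; congr powR; ring.
have e2 : t `^ ((1 - x) / x) = t * expR (- ((1 - 2 * x) / x) * - ln t).
  by rewrite tp; congr powR; field; rewrite gt_eqF.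
have e3 : t `^ (1 - x) = t * expR (x * - ln t) by rewrite tp.
have := mulr_gt0 t0 h; rewrite e1 e2 e3.
move: (expR _) (expR _) (expR _) (_ * (_ / _)) => A B C D.
by congr (0 < _); ring.
Qed.

(** * Logarithms of finite q-shifted factorials *)

Local Open Scope classical_set_scope.

(** The difference between ln (1 - w) and its Taylor polynomial of degree n has
    derivative - w^n / (1 - w), so by the mean value theorem it is at most
    z^(n+1) / (1 - z) in absolute value at w = z. *)
Lemma cvg_ln_series (R : realType) (z : R) : 0 <= z -> z < 1 ->
  (fun n => \sum_(0 <= k < n) z ^+ k.+1 / k.+1%:R) @ \oo --> - ln (1 - z).
Proof.
move=> z0 z1.
pose f n (w : R) : R := ln (1 - w) + \sum_(0 <= k < n) w ^+ k.+1 / k.+1%:R.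
have df n (w : R) : w < 1 -> is_derive w 1 (f n) (- w ^+ n / (1 - w)).
  move=> w1; have w10 : 0 < 1 - w by rewrite subr_gt0.
  elim: n => [|n IH].
    rewrite /f (_ : (fun _ => _) = @ln R \o (cst 1 - id)); last first.
      by apply/funext => v /=; rewrite big_geq // addr0.
    have d1 := is_derive1_ln w10.
    have d2 := is_deriveB (is_derive_cst (1 : R) w 1) (is_derive_id w 1).
    have := @is_derive1_comp R (@ln R) (cst 1 - id) w _ _ d1 d2.
    by rewrite sub0r mulrN1 expr0 mulNr mul1r.
  have -> : f n.+1 = f n + n.+1%:R^-1 *: (id ^+ n.+1 : R -> R).
    apply/funext => v; rewrite /f !fctE big_nat_recr //= addrA.
    by rewrite [_ / _]mulrC.
  have := is_deriveD IH
    (is_deriveZ n.+1%:R^-1 (is_deriveX n.+1 (is_derive_id w 1))).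
  congr is_derive; rewrite /GRing.scale/= mulr1 exprS.
  have n0 : n.+1%:R != 0 :> R by rewrite pnatr_eq0.
  by move: (n.+1%:R) n0 => N n0; field; rewrite n0 gt_eqF.
have bd n : `|f n z| <= z ^+ n * (z / (1 - z)).
  have z10 : 0 < 1 - z by rewrite subr_gt0.
  have [| |c] := @MVT_segment R (f n) (fun w => - w ^+ n / (1 - w)) 0 z z0.
  - move=> w; rewrite in_itv /= => /andP[_ wz].
    by apply: df; apply: lt_trans z1.
  - apply: derivable_within_continuous => w; rewrite in_itv /= => /andP[_ wz].
    exact: (ex_derive (is_derive := df n w (le_lt_trans wz z1))).
  rewrite in_itv /= => /andP[c0 cz].
  have -> : f n 0 = 0.
    rewrite /f subr0 ln1 add0r big1 // => i _.
    by rewrite expr0n mul0r.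
  rewrite !subr0 => ->.
  have c10 : 0 < 1 - c by rewrite subr_gt0 (le_lt_trans cz).
  rewrite mulNr mulNr normrN ger0_norm; last first.
    by rewrite !mulr_ge0 ?exprn_ge0 ?invr_ge0 // ltW.
  rewrite -mulrA [_^-1 * z]mulrC; apply: ler_pM.
  - exact: exprn_ge0.
  - by rewrite divr_ge0 // ltW.
  - by rewrite lerXn2r ?nnegrE.
  - by rewrite ler_wpM2l // lef_pV2 ?posrE // lerB.
have zn : `|z| < 1 by rewrite ger0_norm.
have g0 : (fun n => z ^+ n * (z / (1 - z))) @ \oo --> (0 : R).
  by rewrite -(mul0r (z / (1 - z))); apply: cvgM;
    [exact: cvg_expr|exact: cvg_cst].
have fz : (fun n => f n z) @ \oo --> (0 : R).
  apply/norm_cvg0P; apply: (squeeze_cvgr _ (cvg_cst (0 : R)) g0).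
  by near=> n; rewrite normr_ge0 bd.
rewrite -[- ln _]addr0.
suff -> : (fun n => \sum_(0 <= k < n) z ^+ k.+1 / k.+1%:R) =
    (fun n => - ln (1 - z) + f n z).
  exact: cvgD (cvg_cst _) fz.
by apply/funext => n; rewrite /f addKr.
Unshelve. all: by end_near. Qed.

Definition qPoch (R : realType) (q z : R) (n : nat) : R :=
  \prod_(0 <= i < n) (1 - z * q ^+ i).

Lemma qPochS (R : realType) (q z : R) n :
  qPoch R q z n.+1 = qPoch R q z n * (1 - z * q ^+ n).
Proof. by rewrite /qPoch big_nat_recr. Qed.

Lemma mul_expn_itv (R : realType) (q z : R) n :
  0 < q -> q < 1 -> 0 <= z -> z < 1 -> 0 <= z * q ^+ n < 1.
Proof.
move=> q0 q1 z0 z1; have q0' := ltW q0; apply/andP; split.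
  by rewrite mulr_ge0 // exprn_ge0.
by rewrite (le_lt_trans _ z1) // ler_piMr // exprn_ile1 // ltW.
Qed.

Lemma qPoch_gt0 (R : realType) (q z : R) n :
  0 < q -> q < 1 -> 0 <= z -> z < 1 -> 0 < qPoch R q z n.
Proof.
move=> q0 q1 z0 z1; apply: prodr_gt0 => i _.
by rewrite subr_gt0; case/andP: (mul_expn_itv R q z i q0 q1 z0 z1).
Qed.

(** Summing the logarithmic series of the factors and exchanging the two sums
    makes the geometric sum of the t^i for i < n appear, with t = q^(k+1). *)
Lemma cvg_ln_qPoch (R : realType) (q z : R) n :
  0 < q -> q < 1 -> 0 <= z -> z < 1 ->
  (fun K => \sum_(0 <= k < K)
     z ^+ k.+1 * ((1 - (q ^+ k.+1) ^+ n) / (1 - q ^+ k.+1)) / k.+1%:R) @ \oo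
  --> - ln (qPoch R q z n).
Proof.
move=> q0 q1 z0 z1; elim: n => [|n IH].
  rewrite /qPoch big_geq // ln1 oppr0.
  rewrite (_ : (fun _ => _) = cst 0); first exact: cvg_cst.
  apply/funext => K; rewrite big1 // => k _.
  by rewrite expr0 subrr mul0r mulr0 mul0r.
have /andP[w0 w1] := mul_expn_itv R q z n q0 q1 z0 z1.
rewrite qPochS lnM ?posrE ?qPoch_gt0 ?subr_gt0 // opprD.
apply: cvg_trans (cvgD IH (cvg_ln_series R _ w0 w1)).
apply: near_eq_cvg; near=> K.
rewrite fctE -big_split /=; apply: eq_bigr => k _.
have t1 : 1 - q ^+ k.+1 != 0.
  by rewrite gt_eqF // subr_gt0 exprn_ilt1 // ltW.
have k0 : k.+1%:R != 0 :> R by rewrite pnatr_eq0.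
rewrite exprMn -!exprM [(n * _)%N]mulnC mulnS exprD.
by move: (k.+1%:R) k0 => N k0; field; rewrite t1 k0.
Unshelve. all: by end_near. Qed.

(** * The infinite product *)

(** A bound whose limit is positive: 1 - w >= exp (- w / (1 - w)) for each
    factor w = z q^i, and 1 / (1 - w) <= 1 / (1 - z). *)
Lemma qPoch_lower_bound (R : realType) (q z : R) n :
  0 < q -> q < 1 -> 0 <= z -> z < 1 ->
  expR (- (z / (1 - z) * ((1 - q ^+ n) / (1 - q)))) <= qPoch R q z n.
Proof.
move=> q0 q1 z0 z1; elim: n => [|n IH].
  by rewrite subrr mul0r mulr0 oppr0 expR0 /qPoch big_geq.
have /andP[w0 w1] := mul_expn_itv R q z n q0 q1 z0 z1.
rewrite qPochS.
have -> : - (z / (1 - z) * ((1 - q ^+ n.+1) / (1 - q)))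
   = - (z / (1 - z) * ((1 - q ^+ n) / (1 - q))) - z * q ^+ n / (1 - z).
  by rewrite exprS; field; rewrite !gt_eqF // subr_gt0.
rewrite expRD ler_pM ?expR_ge0 //.
set w := z * q ^+ n in w0 w1 *.
have z10 : 0 < 1 - z by rewrite subr_gt0.
have w10 : 0 < 1 - w by rewrite subr_gt0.
have wz : w <= z by rewrite /w ler_piMr // exprn_ile1 // ltW.
apply: (@le_trans _ _ (expR (- (w / (1 - w))))).
  rewrite ler_expR lerN2 ler_wpM2l // lef_pV2 ?posrE //; lra.
rewrite expRN -[1 - w]invrK lef_pV2 ?posrE ?invr_gt0 ?expR_gt0 //.
apply: le_trans (expR_ge1Dx _).
by rewrite le_eqVlt; apply/orP; left; apply/eqP; field; rewrite gt_eqF.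
Qed.

Lemma qPochhammer_inf_cvg (R : realType) (q z : R) :
  0 < q -> q < 1 -> 0 <= z -> z < 1 ->
  qPoch R q z @ \oo --> qPochhammer_inf z q.
Proof.
move=> q0 q1 z0 z1; apply: nonincreasing_is_cvgn.
  apply/nonincreasing_seqP => n; rewrite qPochS.
  have /andP[w0 w1] := mul_expn_itv R q z n q0 q1 z0 z1.
  by rewrite ler_piMr ?gerBl // ltW // qPoch_gt0.
by exists 0 => _ [n _ <-]; rewrite ltW // qPoch_gt0.
Qed.

Lemma qPochhammer_inf_gt0 (R : realType) (q z : R) :
  0 < q -> q < 1 -> 0 <= z -> z < 1 -> 0 < qPochhammer_inf z q.
Proof.
move=> q0 q1 z0 z1.
apply: (@lt_le_trans _ _ (expR (- (z / (1 - z) * (1 - q)^-1)))).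
  exact: expR_gt0.
apply: cvgr_to_ge (qPochhammer_inf_cvg R q z q0 q1 z0 z1) _.
near=> n; apply: le_trans (qPoch_lower_bound R q z n q0 q1 z0 z1).
have qn : 0 <= q ^+ n by rewrite exprn_ge0 // ltW.
rewrite ler_expR lerN2 ler_wpM2l //.
  by rewrite divr_ge0 // subr_ge0 ltW.
by rewrite ler_piMl ?gerBl // invr_ge0 subr_ge0 ltW.
Unshelve. all: by end_near. Qed.

(** * Comparison of the products *)

Lemma powR_itv01 (R : realType) (q a : R) :
  0 < q -> q < 1 -> 0 < a -> 0 <= q `^ a /\ q `^ a < 1.
Proof.
move=> q0 q1 a0; split; first exact: powR_ge0.
by rewrite /powR gt_eqF // -expR0 ltr_expR pmulr_rlt0 // ln_lt0 ?q0.
Qed.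

Lemma min_le_segment (R : realType) (a b r : R) : 0 <= r <= 1 ->
  Num.min a (a + b) <= a + r * b.
Proof.
move=> /andP[r0 r1].
have [b0|b0] := leP 0 b.
  by rewrite ge_min lerDl mulr_ge0.
by rewrite ge_min lerD2l; apply/orP; right; nra.
Qed.

(** The constant c does not depend on n, which is what keeps the inequality
    strict in the limit. *)
Lemma qPoch_gap (R : realType) (q x : R) : 0 < q -> q < 1 ->
  0 < x -> x < 1 / 2 -> exists2 c : R, 0 < c & forall n,
  expR c * (qPoch R q (q `^ x) n * qPoch R q (q `^ ((1 - x) / x)) n
     * (1 - q) `^ ((1 - 2 * x) * ((1 - x) / x)))
  <= qPoch R q q n * qPoch R q (q `^ (1 - x)) n.
Proof.
move=> q0 q1 x0 x2.
set y := (1 - x) / x; set s := (1 - 2 * x) * y.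
have y0 : 0 < y by rewrite divr_gt0 //; lra.
have s0 : 0 < s by rewrite mulr_gt0 //; lra.
pose b t := (t `^ x + t `^ y - t - t `^ (1 - x)) / (1 - t).
have ab t : 0 < t -> t < 1 -> 0 < Num.min (s * t) (s * t + b t).
  move=> t0 t1; rewrite lt_min mulr_gt0 //=.
  have := powR_gap_gt0 R x t x0 x2 t0 t1; rewrite -/y -/s => h.
  have t10 : 0 < 1 - t by rewrite subr_gt0.
  rewrite (_ : s * t + b t =
    (t `^ x + t `^ y - t - t `^ (1 - x) + s * t * (1 - t)) / (1 - t)).
    by rewrite divr_gt0.
  by rewrite mulrDl mulfK ?gt_eqF // addrC.
exists (Num.min (s * q) (s * q + b q)); first exact: ab.
move=> n.
have pw a := @powR_itv01 R q a q0 q1.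
set X := q `^ x; set Y := q `^ y; set Z := q `^ (1 - x).
have [X0 X1] : 0 <= X /\ X < 1 by apply: pw.
have [Y0 Y1] : 0 <= Y /\ Y < 1 by apply: pw.
have [Z0 Z1] : 0 <= Z /\ Z < 1 by apply: pw; lra.
have q0' := ltW q0.
pose S (K : nat) : R := \sum_(0 <= k < K) (s * q ^+ k.+1
   + (1 - (q ^+ k.+1) ^+ n) * b (q ^+ k.+1)) / k.+1%:R.
have cS : S @ \oo --> ln (qPoch R q q n) + ln (qPoch R q Z n)
   - ln (qPoch R q X n) - ln (qPoch R q Y n) - s * ln (1 - q).
  have cg (z : R) (z0 : 0 <= z) (z1 : z < 1) :=
    cvg_ln_qPoch R q z n q0 q1 z0 z1.
  have h := cvgD 
    (cvgB (cvgB (cvgD (cg X X0 X1) (cg Y Y0 Y1)) (cg q q0' q1)) (cg Z Z0 Z1))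
    (cvgM (cvg_cst s) (cvg_ln_series R q q0' q1)).
  rewrite (_ : _ - _ = - ln (qPoch R q X n) + - ln (qPoch R q Y n)
     - - ln (qPoch R q q n) - - ln (qPoch R q Z n) + s * - ln (1 - q));
    last by ring.
  apply: cvg_trans (h _ _ _ _ _ _); apply: near_eq_cvg; near=> K.
  rewrite !fctE /S /= mulr_sumr -big_split /= -!sumrB -big_split /=.
  apply: eq_bigr => k _.
  have pk a : q `^ a ^+ k.+1 = (q ^+ k.+1) `^ a.
    by rewrite -powR_mulrn ?powR_ge0 // powRAC powR_mulrn.
  rewrite /b -!pk -/X -/Y -/Z.
  have t1 : 1 - q ^+ k.+1 != 0.
    by rewrite gt_eqF // subr_gt0 exprn_ilt1.
  have k0 : k.+1%:R != 0 :> R by rewrite pnatr_eq0.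
  by move: (k.+1%:R) k0 => N k0; field; rewrite t1 k0.
(* The term k = 0 alone provides the gap, the other ones being nonnegative. *)
have Sge : Num.min (s * q) (s * q + b q) <=
  ln (qPoch R q q n) + ln (qPoch R q Z n)
   - ln (qPoch R q X n) - ln (qPoch R q Y n) - s * ln (1 - q).
  apply: cvgr_to_ge cS _; near=> K.
  have K0 : (0 < K)%N by near: K; exact: nbhs_infty_gt.
  have r01 k : 0 <= 1 - (q ^+ k.+1) ^+ n <= 1.
    have t0 : 0 <= (q ^+ k.+1) ^+ n by rewrite !exprn_ge0.
    have t1 : (q ^+ k.+1) ^+ n <= 1 by rewrite !exprn_ile1 ?exprn_ge0 // ltW.
    by rewrite subr_ge0 t1 gerBl.
  rewrite /S big_ltn // divr1 expr1.
  rewrite -[leLHS]addr0 lerD //.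
    by have := min_le_segment R (s * q) (b q) _ (r01 0%N); rewrite expr1.
  apply: sumr_ge0 => k _; rewrite divr_ge0 //.
  apply: le_trans (min_le_segment R _ _ _ (r01 k)).
  by rewrite ltW // ab ?exprn_gt0 // exprn_ilt1.
have q10 : 0 < 1 - q by rewrite subr_gt0.
rewrite -ler_ln ?posrE ?mulr_gt0 ?expR_gt0 ?powR_gt0 ?qPoch_gt0 //.
rewrite !lnM ?expRK ?ln_powR ?posrE ?mulr_gt0 ?expR_gt0 ?powR_gt0 ?qPoch_gt0 //.
by lra.
Unshelve. all: by end_near. Qed.

Lemma qGamma_ineq_strict (R : realType) (q x : R) : 0 < q -> q < 1 ->
  0 < x -> x < 1 / 2 ->
  qGamma q (1 - x) / qGamma q x < qGamma q ((1 - x) / x).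
Proof.
move=> q0 q1 x0 x2.
have [c c0 hc] := qPoch_gap R q x q0 q1 x0 x2.
have y0 : 0 < (1 - x) / x by rewrite divr_gt0 //; lra.
have q0' := ltW q0.
have pw a := @powR_itv01 R q a q0 q1.
have [X0 X1] := pw _ x0.
have [Y0 Y1] := pw _ y0.
have [|Z0 Z1] := pw (1 - x); first by lra.
have cv z z0 z1 := qPochhammer_inf_cvg R q z q0 q1 z0 z1.
have gt z z0 z1 := qPochhammer_inf_gt0 R q z q0 q1 z0 z1.
have hl : expR c * (qPochhammer_inf (q `^ x) q *
      qPochhammer_inf (q `^ ((1 - x) / x)) q *
      (1 - q) `^ ((1 - 2 * x) * ((1 - x) / x)))
    <= qPochhammer_inf q q * qPochhammer_inf (q `^ (1 - x)) q.
  apply: ler_cvg_to (cvgM (cvg_cst (expR c))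
    (cvgM (cvgM (cv _ X0 X1) (cv _ Y0 Y1)) (cvg_cst _)))
    (cvgM (cv _ q0' q1) (cv _ Z0 Z1)) _.
  by near=> n; exact: hc.
have := (gt _ X0 X1, gt _ Y0 Y1, gt _ Z0 Z1, gt _ q0' q1).
rewrite /qGamma.
move: (qPochhammer_inf (q `^ x) q) (qPochhammer_inf (q `^ ((1 - x) / x)) q)
  (qPochhammer_inf (q `^ (1 - x)) q) (qPochhammer_inf q q) hl.
move=> PX PY PZ Pq hl [[[PX0 PY0] PZ0] Pq0].
have r0 : 0 < 1 - q by rewrite subr_gt0.
set y := (1 - x) / x in hl y0 *; set s := (1 - 2 * x) * y in hl.
have pD a b : (1 - q) `^ (a + b) = (1 - q) `^ a * (1 - q) `^ b.
  by rewrite powRD //; apply/implyP => _; rewrite gt_eqF.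
have e : (1 - q) `^ (1 - (1 - x)) =
    (1 - q) `^ s * (1 - q) `^ (1 - x) * (1 - q) `^ (1 - y).
  by rewrite -!pD; congr powR; rewrite /s /y; field; rewrite gt_eqF.
rewrite e.
have A0 : 0 < (1 - q) `^ s by rewrite powR_gt0.
have B0 : 0 < (1 - q) `^ (1 - x) by rewrite powR_gt0.
have C0 : 0 < (1 - q) `^ (1 - y) by rewrite powR_gt0.
have lt : PX * PY * (1 - q) `^ s < Pq * PZ.
  apply: lt_le_trans hl; rewrite ltr_pMl ?mulr_gt0 //.
  by rewrite expR_gt1.
move: ((1 - q) `^ s) ((1 - q) `^ (1 - x)) ((1 - q) `^ (1 - y))
  A0 B0 C0 lt {hl e}.
move=> A B C A0 B0 C0 lt.
rewrite -subr_gt0.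
rewrite (_ : _ - _ = (Pq * PZ - PX * PY * A) * (C / (PY * PZ))).
  by rewrite mulr_gt0 ?subr_gt0 // divr_gt0 // mulr_gt0.
by field; rewrite !gt_eqF.
Unshelve. all: by end_near. Qed.

Theorem theorem8 (R : realType) (q : R) (hq0 : 0 < q) (hq1 : q < 1)
    (x : R) (hx0 : 0 < x) (hx1 : x <= 1 / 2) :
  qGamma q (1 - x) / qGamma q x <= qGamma q ((1 - x) / x) /\
  (qGamma q (1 - x) / qGamma q x = qGamma q ((1 - x) / x) <-> x = 1 / 2).
Proof.
have [x2|x2] := eqVneq x (1 / 2); last first.
  have x2' : x < 1 / 2 by rewrite lt_neqAle x2.
  have lt := qGamma_ineq_strict R q x hq0 hq1 hx0 x2'.
  split; first exact: ltW.
  by split => e; [rewrite e ltxx in lt|rewrite e eqxx in x2].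
have hq0' := ltW hq0.
suff e : qGamma q (1 - x) / qGamma q x = qGamma q ((1 - x) / x).
  by rewrite e; split.
(* At x = 1/2 both sides are 1: the arguments are 1/2, 1/2 and 1. *)
have -> : 1 - x = x by rewrite x2; field.
rewrite [x / x]divff ?gt_eqF // /qGamma subrr powRr0 powRr1 // mulr1.
rewrite !divff //; first by rewrite gt_eqF // qPochhammer_inf_gt0.
have [X0 X1] := @powR_itv01 R q x hq0 hq1 hx0.
rewrite gt_eqF // !mulr_gt0 ?invr_gt0 ?qPochhammer_inf_gt0 ?powR_gt0 //.
by rewrite subr_gt0.
Qed.
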